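(* Let $(H,[-,-,-])$ be an Abelian heap. For any element $e\in H$, the set $H\times\mathrm{End}(H,+_e)$ is a truss, isomorphic to the endomorphism truss $E(H)$, with the product heap structure and the semi-direct product monoid operation: for all $(x,\alpha),(y,\beta)\in H\times\mathrm{End}(H,+_e)$, $$(x,\alpha)(y,\beta):=(x+_e\alpha(y),\alpha\circ\beta)=([x,e,\alpha(y)],\alpha\circ\beta).$$
   Context: A heap is a non-empty set $H$ with a ternary operation $[-,-,-]$ satisfying $[v,w,[x,y,z]]=[[v,w,x],y,z]$ and $[x,x,y]=y=[y,x,x]$; it is Abelian if $[x,y,z]=[z,y,x]$. A heap morphism is a function preserving the ternary operations. For an Abelian heap $H$ and $e\in H$, the operation $x+_e y=[x,e,y]$ makes $H$ into an Abelian group with neutral element $e$; $\mathrm{End}(H,+_e)$ denotes the monoid (under composition) of endomorphisms of this group, regarded as a heap with the pointwise operation $[\alpha,\beta,\gamma](x)=[\alpha(x),\beta(x),\gamma(x)]$. A truss is an Abelian heap $T$ with an associative binary operation (juxtaposition) satisfying $w[x,y,z]=[wx,wy,wz]$ and $[x,y,z]w=[xw,yw,zw]$. An isomorphism of trusses is a bijection preserving both operations. The endomorphism truss $E(H)$ is the set of all heap endomorphisms of $H$ with the pointwise heap operation $[\alpha,\beta,\gamma](x)=[\alpha(x),\beta(x),\gamma(x)]$ and composition of functions as binary operation. The product heap structure is $[(x,\alpha),(y,\beta),(z,\gamma)]=([x,y,z],[\alpha,\beta,\gamma])$. *)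

(* Defs.v *)
From HB Require Import structures.
From mathcomp Require Import all_boot all_algebra.
From mathcomp Require Import boolp.

Set Implicit Arguments.
Unset Strict Implicit.
Unset Printing Implicit Defensive.

Import GRing.Theory.
Local Open Scope ring_scope.

Record is_heap (T : Type) (br : T -> T -> T -> T) : Prop := IsHeap {
  heap_inhabited : inhabited T;
  heap_assoc : forall v w x y z, br v w (br x y z) = br (br v w x) y z;
  heap_malcev_l : forall x y, br x x y = y;
  heap_malcev_r : forall x y, br y x x = y
}.

Record is_abelian_heap (T : Type) (br : T -> T -> T -> T) : Prop :=
  IsAbelianHeap {
    abelian_heap_heap : is_heap br;
    abelian_heap_comm : forall x y z, br x y z = br z y x
  }.

Record is_truss (T : Type) (br : T -> T -> T -> T) (mul : T -> T -> T) : Prop :=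
  IsTruss {
    truss_abelian_heap : is_abelian_heap br;
    truss_mulA : associative mul;
    truss_mulDr : forall w x y z,
      mul w (br x y z) = br (mul w x) (mul w y) (mul w z);
    truss_mulDl : forall w x y z,
      mul (br x y z) w = br (mul x w) (mul y w) (mul z w)
  }.

Structure abelianHeap := AbelianHeap {
  heap_sort :> Type;
  heap_br : heap_sort -> heap_sort -> heap_sort -> heap_sort;
  abelianHeapP : is_abelian_heap heap_br
}.

Structure truss := Truss {
  truss_sort :> Type;
  truss_br : truss_sort -> truss_sort -> truss_sort -> truss_sort;
  truss_mul : truss_sort -> truss_sort -> truss_sort;
  trussP : is_truss truss_br truss_mul
}.

Definition heap_morphism (H K : abelianHeap) (f : H -> K) : Prop :=
  forall x y z, f (heap_br x y z) = heap_br (f x) (f y) (f z).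

Definition truss_isomorphic (S T : truss) : Prop :=
  exists f : S -> T,
    [/\ bijective f,
        forall x y z, f (truss_br x y z) = truss_br (f x) (f y) (f z)
      & forall x y, f (truss_mul x y) = truss_mul (f x) (f y)].

Section HeapLemmas.
Variable H : abelianHeap.
Implicit Types v w x y z : H.

Lemma brA v w x y z :
  heap_br v w (heap_br x y z) = heap_br (heap_br v w x) y z.
Proof. exact: heap_assoc (abelian_heap_heap (abelianHeapP H)) _ _ _ _ _. Qed.

Lemma brxxy x y : heap_br x x y = y.
Proof. exact: heap_malcev_l (abelian_heap_heap (abelianHeapP H)) _ _. Qed.

Lemma bryxx x y : heap_br y x x = y.
Proof. exact: heap_malcev_r (abelian_heap_heap (abelianHeapP H)) _ _. Qed.

Lemma brC x y z : heap_br x y z = heap_br z y x.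
Proof. exact: abelian_heap_comm (abelianHeapP H) _ _ _. Qed.

End HeapLemmas.

(* [retract e] is the carrier of H seen as the abelian group (H, +_e). The
   choice structure required by [zmodType] is the classical one, so that
   nothing is assumed of H. *)
Definition retract (H : abelianHeap) (e : H) : Type := H.

Definition retract_add (H : abelianHeap) (e x y : H) : H := heap_br x e y.

Definition retract_opp (H : abelianHeap) (e x : H) : H := heap_br e x e.

Section Retract.
Variables (H : abelianHeap) (e : H).

Lemma retract_addA : associative (retract_add e).
Proof. by move=> x y z; rewrite /retract_add brA. Qed.

Lemma retract_addC : commutative (retract_add e).
Proof. by move=> x y; rewrite /retract_add brC. Qed.

Lemma retract_add0 : left_id e (retract_add e).
Proof. by move=> x; rewrite /retract_add brxxy. Qed.

Lemma retract_addN : left_inverse e (retract_opp e) (retract_add e).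
Proof. by move=> x; rewrite /retract_add /retract_opp -brA brxxy bryxx. Qed.

HB.instance Definition _ := gen_eqMixin (retract e).
HB.instance Definition _ := gen_choiceMixin (retract e).
HB.instance Definition _ := GRing.isZmodule.Build (retract e)
  retract_addA retract_addC retract_add0 retract_addN.

Lemma brE (x y z : H) :
  heap_br x y z = (x : retract e) - (y : retract e) + (z : retract e).
Proof.
change (heap_br x y z = heap_br (heap_br x e (heap_br e y e)) e z).
by rewrite brA bryxx -brA brxxy.
Qed.

End Retract.

Lemma br_interchange (H : abelianHeap) (a b c a' b' c' a'' b'' c'' : H) :
  heap_br (heap_br a a' a'') (heap_br b b' b'') (heap_br c c' c'') =
  heap_br (heap_br a b c) (heap_br a' b' c') (heap_br a'' b'' c'').
Proof.
rewrite !(brE a) !opprD !opprK.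
by rewrite (AC (3*3*3) ((1*4*7)*(2*5*8)*(3*6*9))).
Qed.

Section EndoTruss.
Variable H : abelianHeap.

Record heap_endo := HeapEndo {
  endo_fun :> H -> H;
  endo_morph : heap_morphism endo_fun
}.

Lemma heap_endo_ext (f g : heap_endo) : f =1 g -> f = g.
Proof.
case: f g => [f fP] [g gP] /= /funext fg.
by case: _ / fg gP => gP; congr HeapEndo; exact: Prop_irrelevance.
Qed.

Lemma endo_br_morph (f g h : heap_endo) :
  heap_morphism (fun x => heap_br (f x) (g x) (h x)).
Proof. by move=> x y z; rewrite !endo_morph br_interchange. Qed.

Definition endo_br (f g h : heap_endo) : heap_endo :=
  HeapEndo (endo_br_morph f g h).

Lemma endo_mul_morph (f g : heap_endo) : heap_morphism (f \o g).
Proof. by move=> x y z; rewrite /= !endo_morph. Qed.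

Definition endo_mul (f g : heap_endo) : heap_endo :=
  HeapEndo (endo_mul_morph f g).

Lemma heap_id_morph : heap_morphism (fun x : H => x).
Proof. by []. Qed.

Lemma endo_is_truss : is_truss endo_br endo_mul.
Proof.
split=> [|f g h|f g h k|f g h k]; last 3 first.
- exact: heap_endo_ext.
- by apply: heap_endo_ext => x /=; rewrite endo_morph.
- exact: heap_endo_ext.
split; last by move=> f g h; apply: heap_endo_ext => x; exact: brC.
split; first exact: inhabits (HeapEndo heap_id_morph).
- by move=> *; apply: heap_endo_ext => x; exact: brA.
- by move=> *; apply: heap_endo_ext => x; exact: brxxy.
- by move=> *; apply: heap_endo_ext => x; exact: bryxx.
Qed.

Definition endo_truss : truss := Truss endo_is_truss.

End EndoTruss.

Section SemiDirect.
Variables (H : abelianHeap) (e : H).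

Definition retract_end : Type := {additive retract e -> retract e}.

Definition retract_end_br_fun (f g h : retract_end) (x : retract e) :
  retract e := heap_br (f x : H) (g x) (h x).

Lemma retract_end_br_additive (f g h : retract_end) :
  zmod_morphism (retract_end_br_fun f g h).
Proof.
move=> x y; rewrite /retract_end_br_fun !raddfB !(brE e) !opprD !opprK.
by rewrite (AC (2*2*2) ((1*3*5)*(2*4*6))).
Qed.

HB.instance Definition _ (f g h : retract_end) :=
  GRing.isZmodMorphism.Build (retract e) (retract e)
    (retract_end_br_fun f g h) (retract_end_br_additive f g h).

Definition retract_end_br (f g h : retract_end) : retract_end :=
  retract_end_br_fun f g h.

Definition retract_end_comp (f g : retract_end) : retract_end := f \o g.

Definition retract_end_id : retract_end := idfun.

Definition semidirect : Type := (H * retract_end)%type.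

Definition semidirect_br (p q r : semidirect) : semidirect :=
  (heap_br p.1 q.1 r.1, retract_end_br p.2 q.2 r.2).

Definition semidirect_mul (p q : semidirect) : semidirect :=
  (retract_add e p.1 (p.2 q.1), retract_end_comp p.2 q.2).

Definition semidirect_one : semidirect := (e, retract_end_id).

End SemiDirect.

(* Main.v *)
(* Evaluating (x, alpha) at y as x +_e alpha y identifies a pair with the affine
   map "translation after group endomorphism".  Every heap endomorphism phi
   arises from exactly one pair, x = phi e and alpha = phi - phi e.  Products
   and brackets of pairs go to composites and pointwise brackets of maps, so
   the truss axioms are inherited from E(H). *)
From HB Require Import structures.
Require Import Defs.
From mathcomp Require Import all_boot all_algebra.
From mathcomp Require Import boolp.

Set Implicit Arguments.
Unset Strict Implicit.
Unset Printing Implicit Defensive.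

Import GRing.Theory.
Local Open Scope ring_scope.

(** An additive map bundles a function with a proof of additivity, so proof irrelevance leaves only
    the functions to compare. *)
Lemma additive_ext (U V : zmodType) (f g : {additive U -> V}) :
  f =1 g -> f = g.
Proof.
case: f g => [f fP] [g gP] /= /funext fg.
case: _ / fg gP => gP; case: fP gP => [[fP]] [[gP]].
by rewrite (Prop_irrelevance fP gP).
Qed.

(** All truss axioms but non-emptiness are identities in the two operations, so they can be checked
    after applying the injective [f]. *)
Lemma is_truss_inj (S : Type) (br : S -> S -> S -> S) (mul : S -> S -> S)
    (T : truss) (f : S -> T) :
  inhabited S -> injective f ->
  (forall x y z, f (br x y z) = truss_br (f x) (f y) (f z)) ->
  (forall x y, f (mul x y) = truss_mul (f x) (f y)) ->
  is_truss br mul.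
Proof.
move=> S0 f_inj f_br f_mul.
case: (trussP T) => [[[_ bA bl br_r] bC] mA mDr mDl].
split=> [|x y z|w x y z|w x y z]; last 3 first.
- by apply: f_inj; rewrite !f_mul mA.
- by apply: f_inj; rewrite !(f_mul, f_br) mDr.
- by apply: f_inj; rewrite !(f_mul, f_br) mDl.
split; last by move=> x y z; apply: f_inj; rewrite !f_br bC.
split=> // *; apply: f_inj; rewrite !f_br.
- exact: bA.
- exact: bl.
- exact: br_r.
Qed.

Section AffineMaps.
Variables (H : abelianHeap) (e : H).

Lemma retract_end_heap_morphism (g : retract_end e) (x y z : H) :
  g (heap_br x y z) = heap_br (g x : H) (g y) (g z).
Proof. by rewrite !(brE e) raddfD raddfB. Qed.

Lemma retract_end_base (g : retract_end e) : g e = e.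
Proof. exact: (raddf0 g). Qed.

Lemma semidirect_endo_morph (p : semidirect e) :
  heap_morphism (fun y : H => heap_br p.1 e (p.2 y) : H).
Proof.
move=> x y z; rewrite retract_end_heap_morphism.
(* Interchange regroups the right-hand side by columns; the columns of [p.1] and of [e] collapse. *)
by rewrite -br_interchange !brxxy.
Qed.

Definition semidirect_endo (p : semidirect e) : heap_endo H :=
  HeapEndo (semidirect_endo_morph p).

Lemma semidirect_endo_base (p : semidirect e) : semidirect_endo p e = p.1.
Proof. by rewrite /= retract_end_base bryxx. Qed.

(** The value at [e] recovers the first component; cancelling it in the group recovers the
    second. *)
Lemma semidirect_endo_inj : injective semidirect_endo.
Proof.
move=> p q pq.
have pq1 : p.1 = q.1 by rewrite -!semidirect_endo_base pq.
have pq2 : p.2 = q.2.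
  apply: additive_ext => y.
  have : semidirect_endo p y = semidirect_endo q y by rewrite pq.
  by rewrite /= pq1 !(brE e) => /(@addrI (retract e)).
by case: p q pq1 pq2 {pq} => [x g] [x' g'] /= -> ->.
Qed.

Lemma br_base (x y : H) : heap_br x y e = (x : retract e) - (y : retract e).
Proof. by rewrite (brE e); exact: (@addr0 (retract e)). Qed.

Definition linear_part (phi : heap_endo H) (y : retract e) : retract e :=
  heap_br (phi y) (phi e) e.

Lemma linear_part_additive (phi : heap_endo H) :
  zmod_morphism (linear_part phi).
Proof.
(* Writing [x - y] as the bracket [[x, y, e]] lets [phi] distribute over it. *)
move=> x y; rewrite /linear_part -(br_base x y) endo_morph (brE e (phi x)).
by rewrite !br_base opprB addrA subrK addrK.
Qed.

HB.instance Definition _ (phi : heap_endo H) :=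
  GRing.isZmodMorphism.Build (retract e) (retract e)
    (linear_part phi) (linear_part_additive phi).

Definition endo_semidirect (phi : heap_endo H) : semidirect e :=
  (phi e, linear_part phi : retract_end e).

Lemma endo_semidirectK : cancel endo_semidirect semidirect_endo.
Proof.
by move=> phi; apply: heap_endo_ext => y /=; rewrite brC -brA brxxy bryxx.
Qed.

(** A right inverse of an injective map is also a left inverse. *)
Lemma semidirect_endoK : cancel semidirect_endo endo_semidirect.
Proof. exact: inj_can_sym endo_semidirectK semidirect_endo_inj. Qed.

Lemma semidirect_endo_br (p q r : semidirect e) :
  semidirect_endo (semidirect_br p q r) =
  endo_br (semidirect_endo p) (semidirect_endo q) (semidirect_endo r).
Proof.
apply: heap_endo_ext => y /=.
by rewrite -br_interchange brxxy.
Qed.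

Lemma semidirect_endo_mul (p q : semidirect e) :
  semidirect_endo (semidirect_mul p q) =
  endo_mul (semidirect_endo p) (semidirect_endo q).
Proof.
apply: heap_endo_ext => y /=.
(* The linear part of [p] preserves the inner bracket and fixes [e]; reassociating finishes. *)
by rewrite retract_end_heap_morphism retract_end_base brA.
Qed.

End AffineMaps.

Theorem proposition3p44 (H : abelianHeap) (e : H) :
  exists sdP : is_truss (@semidirect_br H e) (@semidirect_mul H e),
    truss_isomorphic (Truss sdP) (endo_truss H) /\
    left_id (semidirect_one e) (@semidirect_mul H e) /\
    right_id (semidirect_one e) (@semidirect_mul H e).
Proof.
have sdP : is_truss (@semidirect_br H e) (@semidirect_mul H e).
  apply: (@is_truss_inj _ _ _ (endo_truss H) (@semidirect_endo H e)).
  - exact: inhabits (semidirect_one e).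
  - exact: semidirect_endo_inj.
  - exact: semidirect_endo_br.
  - exact: semidirect_endo_mul.
exists sdP; split; last split.
- exists (@semidirect_endo H e); split.
  + by exists (@endo_semidirect H e);
      [exact: semidirect_endoK | exact: endo_semidirectK].
  + exact: semidirect_endo_br.
  + exact: semidirect_endo_mul.
(* The unit pair acts as [y] to [[e, e, y]], the identity map, so both unit laws hold after
   evaluation. *)
- move=> p; apply: semidirect_endo_inj; rewrite semidirect_endo_mul.
  by apply: heap_endo_ext => y /=; rewrite brxxy.
- move=> p; apply: semidirect_endo_inj; rewrite semidirect_endo_mul.
  by apply: heap_endo_ext => y /=; rewrite brxxy.
Qed.
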